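(* Let $\mathcal{V}=\mathcal{B}=\textsc{Gs}$ and consider any declared welfare maximizer mechanism. Then for every $\gamma\ge 0$, $\textsc{PoA}_\gamma\le 4+2\gamma$. That is, for every profile $\mathbf{v}\in\textsc{Gs}^n$ of true valuations and every pure Nash equilibrium $\mathbf{b}\in\textsc{Gs}^n$ in which every agent's strategy $b_i$ has exposure factor $\gamma$, $\sum_i v_i(\mathbf{x}^*_i)\le(4+2\gamma)\sum_i v_i(\mathbf{x}_i(\mathbf{b}))$, where $(\mathbf{x}^*_i)_i$ is a partition of the items maximizing $\sum_i v_i(\mathbf{x}^*_i)$.
   Context: There are $m$ items and $n$ agents. A valuation is $v:\{0,1\}^m\to\mathbb{R}_+$ with $v(\mathbf{0})=0$ and monotone. Demand at prices $\mathbf{p}$: $D_v(\mathbf{p})=\arg\max_{\mathbf{x}\in\{0,1\}^m}[v(\mathbf{x})-\mathbf{p}\cdot\mathbf{x}]$. $v\in\textsc{Gs}$ (gross substitutes) if for all prices $\mathbf{p}\le\mathbf{q}$, $S=\{j:p_j=q_j\}$, and $\mathbf{x}\in D_v(\mathbf{p})$, there is $\mathbf{y}\in D_v(\mathbf{q})$ with $y_j\ge x_j$ for all $j\in S$. A mechanism with bidding space $\mathcal{B}$ consists of allocation maps $\mathbf{x}_i:\mathcal{B}^n\to\{0,1\}^m$ with $\sum_i\mathbf{x}_i(\mathbf{b})\le\mathbf{1}$ and payment maps $\pi_i:\mathcal{B}^n\to\mathbb{R}_+$; utility is $u_i(v_i;\mathbf{b})=v_i(\mathbf{x}_i(\mathbf{b}))-\pi_i(\mathbf{b})$.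 It is a declared welfare maximizer if $\mathbf{x}_1(\mathbf{b}),\dots,\mathbf{x}_n(\mathbf{b})$ is a partition of the items maximizing $\sum_i b_i(\mathbf{x}_i)$, and (i) $\pi_i(\mathbf{b})\le b_i(\mathbf{x}_i(\mathbf{b}))$ for all $\mathbf{b}$, $i$; (ii) for every $\mathbf{b}$ and $i$ there is $\mathbf{b}'_{-i}$ with $\mathbf{x}_i(b_i,\mathbf{b}'_{-i})=\mathbf{x}_i(\mathbf{b})$ and $\pi_i(b_i,\mathbf{b}'_{-i})=b_i(\mathbf{x}_i(\mathbf{b}))$. A strategy $b_i$ has exposure factor $\gamma$ (for true valuation $v_i$) if $\pi_i(b_i,\mathbf{b}_{-i})\le(1+\gamma)v_i(\mathbf{x}_i(b_i,\mathbf{b}_{-i}))$ for all $\mathbf{b}_{-i}\in\mathcal{B}^{n-1}$. A pure Nash equilibrium is $\mathbf{b}\in\mathcal{B}^n$ with $u_i(v_i;\mathbf{b})\ge u_i(v_i;b_i',\mathbf{b}_{-i})$ for all $i$, $b_i'\in\mathcal{B}$. $\textsc{PoA}_\gamma$ is the maximum over $\mathbf{v}\in\mathcal{V}^n$ and over pure Nash equilibria in which all strategies have exposure factor $\gamma$ of the ratio of optimal welfare to equilibrium welfare (defined as $1$ if no such equilibrium exists). *)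

(* Defs.v *)
From HB Require Import structures.
From mathcomp Require Import all_boot all_order all_algebra.
From mathcomp Require Import reals.
Set Implicit Arguments. Unset Strict Implicit. Unset Printing Implicit Defensive.
Import Order.TTheory GRing.Theory Num.Theory.
Local Open Scope ring_scope.

Section Auction.
Variables (R : realType) (m n : nat).

(* A bundle x in {0,1}^m is represented as a subset of the items 'I_m. *)
Definition bundle := {set 'I_m}.
Definition valfun := bundle -> R.
Definition profile := 'I_n -> valfun.
Definition prices := 'I_m -> R.

Definition is_valuation (v : valfun) : Prop :=
  v set0 = 0 /\ (forall S T : bundle, S \subset T -> v S <= v T).

Definition price_of (p : prices) (S : bundle) : R := \sum_(j in S) p j.

Definition in_demand (v : valfun) (p : prices) (S : bundle) : Prop :=
  forall T : bundle, v T - price_of p T <= v S - price_of p S.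

Definition is_GS (v : valfun) : Prop :=
  is_valuation v /\
  forall p q : prices, (forall j, p j <= q j) ->
  forall S : bundle, in_demand v p S ->
  exists T : bundle, in_demand v q T /\
    (forall j, j \in S -> p j = q j -> j \in T).

Definition upd (b : profile) (i : 'I_n) (bi : valfun) : profile :=
  fun k => if k == i then bi else b k.

Definition GS_profile (b : profile) : Prop := forall i, is_GS (b i).

Definition is_partition (y : 'I_n -> bundle) : Prop :=
  (forall i k, i != k -> [disjoint y i & y k]) /\
  (forall j : 'I_m, exists i, j \in y i).

Definition welfare (v : profile) (y : 'I_n -> bundle) : R :=
  \sum_(i < n) v i (y i).

Variables (x : profile -> 'I_n -> bundle) (pi : profile -> 'I_n -> R).

Definition declared_welfare_maximizer : Prop :=
  forall b : profile, GS_profile b ->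
  [/\ is_partition (x b),
      (forall y, is_partition y -> welfare b y <= welfare b (x b)),
      (forall i, 0 <= pi b i),
      (forall i, pi b i <= b i (x b i)) &
      (forall i, exists b' : profile, GS_profile b' /\
          x (upd b' i (b i)) i = x b i /\
          pi (upd b' i (b i)) i = b i (x b i))].

Definition utility (vi : valfun) (b : profile) (i : 'I_n) : R :=
  vi (x b i) - pi b i.

Definition exposure (gamma : R) (vi : valfun) (i : 'I_n) (bi : valfun) : Prop :=
  forall b' : profile, GS_profile b' ->
    pi (upd b' i bi) i <= (1 + gamma) * vi (x (upd b' i bi) i).

Definition pure_nash (v b : profile) : Prop :=
  GS_profile b /\
  forall i (bi' : valfun), is_GS bi' ->
    utility (v i) (upd b i bi') i <= utility (v i) b i.

End Auction.

(* Main.v *)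
(* Let a be additive prices supporting v_i at xstar_i, and let agent i deviate to
   the additive bid a/2, winning T.  The payment is at most a(T)/2 <= v_i(T)/2, so
   the deviation yields at least a(T)/2, and optimality of the declared allocation
   gives a(T)/2 >= v_i(xstar_i)/2 - [B_{-i}(M) - B_{-i}(M \ xstar_i)].  For gross
   substitutes the bracket is at most B(M) - B(M \ xstar_i), and by submodularity
   these losses sum over i to at most B(M), the declared welfare.  Bounded exposure
   gives B(M) <= (1 + gamma) SW, hence SW >= OPT/2 - (1 + gamma) SW.
   The comparison between B_{-i} and B uses prices: B is, up to any e > 0, the
   minimum over p of the sum of the indirect utilities plus p(M)
   (Kelso-Crawford), and indirect utilities are submodular in p. *)
Require Import Defs.
From HB Require Import structures.
From mathcomp Require Import all_boot all_order all_algebra.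
From mathcomp Require Import reals boolp lra.
Import Order.TTheory GRing.Theory Num.Theory.
Local Open Scope ring_scope.

Section GrossSubstitutes.
Context {R : realType} {m : nat}.
Implicit Types (v : valfun R m) (p q r s c : prices R m) (S T A B : bundle m).

(** * Prices and additive valuations *)

Lemma disjoint_setDl A B : [disjoint A :\: B & B].
Proof. by rewrite -setI_eq0 setDE -setIA [~: _ :&: _]setIC setICr setI0. Qed.

Lemma price_ofD1 p S j : j \in S -> price_of p S = p j + price_of p (S :\ j).
Proof. exact: big_setD1. Qed.

Lemma price_of_ge0 p S : (forall j, 0 <= p j) -> 0 <= price_of p S.
Proof. by move=> p0; apply: sumr_ge0. Qed.

Lemma price_of_le p S T :
  (forall j, 0 <= p j) -> S \subset T -> price_of p S <= price_of p T.
Proof.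
move=> p0 ST; rewrite /price_of [leRHS](big_setID S) /= (setIidPr ST).
by rewrite lerDl sumr_ge0.
Qed.

Lemma additive_GS c : (forall j, 0 <= c j) -> is_GS (price_of c).
Proof.
move=> c0; split.
  by split=> [|S T]; [exact: big_set0 | exact: price_of_le].
(* Ties [q j = c j] are included: an item of [S] may have been only tied already at [p]. *)
move=> p q pq S Sp; exists [set j | q j <= c j]; split.
  move=> T; rewrite /price_of -!sumrB [leLHS]big_mkcond [leRHS]big_mkcond /=.
  by apply: ler_sum => j _; rewrite inE; case: ifP; case: ifP => //; lra.
move=> j jS pqj; rewrite inE -pqj.
by have := Sp (S :\ j); rewrite !(price_ofD1 _ S j) //; lra.
Qed.

(** The zero bid stands for an agent removed from the market. *)
Lemma zero_GS : is_GS ((fun=> 0) : valfun R m).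
Proof.
have -> : (fun=> 0) = price_of (fun=> 0) :> valfun R m.
  by apply/funext => T; rewrite /price_of big1.
exact: additive_GS.
Qed.

(** * Indirect utility at given prices *)

Definition indirect_utility v p : R :=
  let S := [arg max_(S > set0) (v S - price_of p S)]%O in v S - price_of p S.

Lemma indirect_utility_ub v p T : v T - price_of p T <= indirect_utility v p.
Proof. by rewrite /indirect_utility; case: arg_maxP => //= S _; apply. Qed.

Lemma indirect_utility_attained v p :
  exists2 S, in_demand v p S & indirect_utility v p = v S - price_of p S.
Proof.
rewrite /indirect_utility; case: arg_maxP => //= S _ Smax; exists S => //.
by move=> T; apply: Smax.
Qed.

Lemma indirect_utility_le v p q :
  (forall j, p j <= q j) -> indirect_utility v q <= indirect_utility v p.
Proof.
move=> pq; have [S _ ->] := indirect_utility_attained v q.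
apply: le_trans (indirect_utility_ub v p S).
by rewrite lerB // /price_of ler_sum.
Qed.

Lemma indirect_utility_zero p :
  (forall j, 0 <= p j) -> indirect_utility (fun=> 0) p = 0.
Proof.
move=> p0; apply: le_anti; apply/andP; split.
  have [S _ ->] := indirect_utility_attained (fun=> 0) p.
  by rewrite sub0r oppr_le0 price_of_ge0.
apply: le_trans (indirect_utility_ub _ p set0).
by rewrite /price_of big_set0 subr0.
Qed.

(** * Submodularity and supporting prices *)

Lemma GS_ge0 v S : is_GS v -> 0 <= v S.
Proof. by move=> [[v0 vmono] _]; rewrite -v0 vmono ?sub0set. Qed.

Lemma GS_le v S T : is_GS v -> S \subset T -> v S <= v T.
Proof. by move=> [[_ vmono] _]; exact: vmono. Qed.

(* Prices -C on a set to be included and C on a set to be excluded make B the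
   only rival of j |: B; raising the prices on B :\: A to C turns B into A
   and leaves the price of j alone. *)
Lemma GS_submodular v A B j : is_GS v -> A \subset B -> j \notin B ->
  v (j |: B) - v B <= v (j |: A) - v A.
Proof.
(* At price [t] a buyer of [B] is indifferent to [j]; [C] exceeds every value, so one wrong item
   already makes a bundle suboptimal. *)
move=> vGS AB jB; pose t := v (j |: B) - v B; pose C := v setT + 1.
have jA : j \notin A by apply: contra jB; apply: (subsetP AB).
have t0 : 0 <= t by rewrite subr_ge0 GS_le ?subsetUr.
have C0 : 0 < C by rewrite ltr_wpDl // GS_ge0.
pose pr (D : bundle m) : prices R m := fun k => if k == j then t else if k \in D then - C else C.
have pin (D T : bundle m) : j \notin D -> j \notin T -> T != D ->
    price_of (pr D) D + C <= price_of (pr D) T.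
  move=> jD jT TD; have [k kTD] : exists k, (k \in T) != (k \in D).
    by apply/existsP; apply: contraR TD => /existsPn E; apply/eqP/setP => k;
      have /negPn/eqP := E k.
  have kj : k != j.
    by apply: contraNneq kTD => ->; rewrite (negPf jT) (negPf jD).
  rewrite /price_of [X in X + C <= _]big_mkcond [leRHS]big_mkcond /=.
  rewrite (bigD1 k) //= [leRHS](bigD1 k) //= addrAC lerD //.
    by move: kTD; rewrite /pr (negPf kj); case: (k \in T); case: (k \in D) => //; lra.
  apply: ler_sum => l _; rewrite /pr; have [->|lj] := eqVneq l j.
    by rewrite (negPf jT) (negPf jD).
  by case: (l \in T); case: (l \in D) => //; lra.
have prU (D T : bundle m) : j \notin T -> price_of (pr D) (j |: T) = t + price_of (pr D) T.
  by move=> jT; rewrite /price_of big_setU1 //= {1}/pr eqxx.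
have bound (D T : bundle m) : j \notin D -> j \notin T -> T != D ->
    v T - price_of (pr D) T < v D - price_of (pr D) D /\
    v (j |: T) - price_of (pr D) (j |: T) < v D - price_of (pr D) D.
  move=> jD jT TD; have := pin D T jD jT TD; rewrite prU //.
  have := GS_le v T setT vGS (subsetT _).
  have := GS_le v (j |: T) setT vGS (subsetT _).
  have := GS_ge0 v D vGS; rewrite /C; lra.
have demB : in_demand v (pr B) (j |: B).
  have prB : v (j |: B) - price_of (pr B) (j |: B) = v B - price_of (pr B) B.
    by rewrite prU // /t; lra.
  move=> T; rewrite prB; have [jT|jT] := boolP (j \in T).
    have [TB|TB] := eqVneq (T :\ j) B.
      by rewrite -(setD1K jT) TB prB.
    have [_] := bound B (T :\ j) jB (negbT (setD11 _ _)) TB.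
    by rewrite setD1K // => /ltW.
  have [-> //|TB] := eqVneq T B.
  by have [/ltW] := bound B T jB jT TB.
have [k|T [Tdem Tin]] := vGS.2 (pr B) (pr A) _ _ demB.
  rewrite /pr; case: eqP => // _; case: ifP; case: ifP => //; try lra.
  by move=> kA; rewrite (subsetP AB).
have jT : j \in T by apply: Tin; rewrite ?setU11 // /pr eqxx.
have TA : T = j |: A.
  rewrite -(setD1K jT); congr (_ |: _); apply/eqP; apply: contraT => TA.
  have [_] := bound A (T :\ j) jA (negbT (setD11 _ _)) TA.
  by rewrite setD1K // ltNge Tdem.
by have := Tdem A; rewrite TA prU // /t; lra.
Qed.

(** Induction on the size of [S]: each item is priced at its marginal value over the earlier ones.
    By submodularity this is at most its marginal value over the earlier items of [T :&: S]. *)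
Lemma GS_supporting_prices v S : is_GS v ->
  exists c, [/\ forall j, 0 <= c j, price_of c S = v S &
                forall T, price_of c T <= v T].
Proof.
move=> vGS; have [N] := ubnP #|S|; elim: N S => // N IH S SN.
have [->|[j jS]] := set_0Vmem S.
  exists (fun=> 0); rewrite /price_of big_set0 vGS.1.1; split=> // T.
  by rewrite big1 // GS_ge0.
have [|c [c0 cS cle]] := IH (S :\ j).
  by move: SN; rewrite (cardsD1 j S) jS.
pose d : prices R m := fun k =>
  if k == j then v S - v (S :\ j) else if k \in S then c k else 0.
have dD1 T : price_of d (T :\ j) = price_of c ((T :&: S) :\ j).
  rewrite /price_of [LHS]big_mkcond [RHS]big_mkcond /=; apply: eq_bigr => k _.
  by rewrite !inE /d; case: eqP => //= _; case: (k \in T); case: (k \in S).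
exists d; split.
- move=> k; rewrite /d; case: eqP => _; last by case: ifP.
  by rewrite subr_ge0 GS_le ?subsetDl.
- by rewrite (price_ofD1 _ S j) // dD1 setIid cS /d eqxx; lra.
move=> T; have le1 := cle ((T :&: S) :\ j).
have [jT|jT] := boolP (j \in T); last first.
  have -> : T = T :\ j by apply/setP => k; rewrite !inE; case: eqP => // ->; exact/negbTE.
  rewrite dD1; apply: le_trans le1 _; apply: GS_le => //.
  by apply/subsetP => k; rewrite !inE => /and3P[->->].
rewrite (price_ofD1 _ T j) // dD1 {1}/d eqxx.
have sub := GS_submodular v ((T :&: S) :\ j) (S :\ j) j vGS
  (setSD _ (subsetIr _ _)) (negbT (setD11 _ _)).
have jTS : j \in T :&: S by rewrite inE jT.
rewrite !setD1K // in sub.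
have := GS_le v (T :&: S) T vGS (subsetIl _ _); lra.
Qed.

(** * Submodularity of the indirect utility in prices *)

Definition shift p j (t : R) : prices R m :=
  fun k => if k == j then p k + t else p k.

Lemma price_of_shift p j (t : R) T :
  price_of (shift p j t) T = price_of p T + (if j \in T then t else 0).
Proof.
have [jT|jT] := boolP (j \in T).
  rewrite !(price_ofD1 _ T j) // {1}/shift eqxx addrAC; congr (_ + _ + _).
  by apply: eq_bigr => k; rewrite !inE /shift => /andP[/negPf->].
rewrite addr0; apply: eq_bigr => k kT.
by rewrite /shift; case: eqP => // kj; rewrite -kj kT in jT.
Qed.

(* If raising the price of j by t costs d > 0 at r, then at r + d on j the item j
   is demanded but not needed; raising the other prices to s keeps j in demand. *)
Lemma indirect_utility_shift_le v r s j (t : R) : is_GS v ->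
  (forall k, r k <= s k) -> r j = s j -> 0 <= t ->
  indirect_utility v r - indirect_utility v (shift r j t) <=
  indirect_utility v s - indirect_utility v (shift s j t).
Proof.
move=> vGS rs rsj t0.
have U_mono p (u w : R) : u <= w ->
    indirect_utility v (shift p j w) <= indirect_utility v (shift p j u).
  by move=> uw; apply: indirect_utility_le => k; rewrite /shift; case: eqP; lra.
have U0 p : indirect_utility v (shift p j 0) = indirect_utility v p.
  by congr indirect_utility; apply/funext => k; rewrite /shift addr0 if_same.
set d := indirect_utility v r - _.
have d0 : 0 <= d by rewrite subr_ge0 -(U0 r) U_mono.
have [S Sdem SU] := indirect_utility_attained v r.
have ub := indirect_utility_ub v (shift r j t).
have [jS|jS] := boolP (j \in S); last first.
  have dle : d <= 0 by have := ub S; rewrite price_of_shift (negPf jS) /d SU; lra.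
  by apply: le_trans dle _; rewrite subr_ge0 -(U0 s) U_mono.
have dt : d <= t by have := ub S; rewrite price_of_shift jS /d SU; lra.
(* Bundles without [j] yield at most the indirect utility at [shift r j t], which is [d] below that
   at [r], so at best they tie with [S]. *)
have Sd : in_demand v (shift r j d) S.
  move=> T; rewrite !price_of_shift jS; have := Sdem T; have := ub T.
  by rewrite price_of_shift; case: (j \in T); rewrite /d SU; lra.
have [k|T [Tdem Tin]] := vGS.2 (shift r j d) (shift s j d) _ _ Sd.
  by rewrite /shift; case: eqP => _; rewrite ?lerD2r.
have jT : j \in T by apply: Tin => //; rewrite /shift eqxx rsj.
have [T' _ T'U] := indirect_utility_attained v (shift s j d).
have := Tdem T'; rewrite -T'U price_of_shift jT => UT.
have := indirect_utility_ub v s T; have := U_mono s d t dt; lra.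
Qed.

(** Prices are raised one item at a time; every item actually raised has equal prices in [r] and
    [s]. *)
Lemma indirect_utility_raise_le v r s (a : 'I_m -> R) : is_GS v ->
  (forall k, r k <= s k) -> (forall k, 0 <= a k) ->
  (forall k, a k != 0 -> r k = s k) ->
  indirect_utility v r - indirect_utility v (fun k => r k + a k) <=
  indirect_utility v s - indirect_utility v (fun k => s k + a k).
Proof.
move=> vGS rs a0 ars.
pose part p (l : seq 'I_m) : prices R m :=
  fun k => if k \in l then p k + a k else p k.
suff main l : indirect_utility v r - indirect_utility v (part r l) <=
    indirect_utility v s - indirect_utility v (part s l).
  have := main (enum 'I_m).
  have E p : part p (enum 'I_m) = fun k => p k + a k.
    by apply/funext => k; rewrite /part mem_enum.
  by rewrite !E.
elim: l => [|j l IH].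
  have E p : part p [::] = p by apply/funext.
  by rewrite !E !subrr.
have [jl|jl] := boolP (j \in l).
  have E p : part p (j :: l) = part p l.
    by apply/funext => k; rewrite /part inE; case: eqP => // ->; rewrite jl.
  by rewrite !E.
have E p : part p (j :: l) = shift (part p l) j (a j).
  apply/funext => k; rewrite /part /shift inE.
  by case: eqP => //= ->; rewrite (negPf jl).
rewrite !E; have [aj|/ars rsj] := eqVneq (a j) 0.
  have E0 p : shift p j 0 = p.
    by apply/funext => k; rewrite /shift addr0 if_same.
  by rewrite aj !E0.
have := indirect_utility_shift_le v (part r l) (part s l) j (a j) vGS _ _ (a0 j).
have le1 k : part r l k <= part s l k by rewrite /part; case: ifP; rewrite ?lerD2r.
have eq1 : part r l j = part s l j by rewrite /part (negPf jl).
by move=> /(_ le1 eq1); lra.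
Qed.

(** The raise [p - min p q] leads from [min p q] to [p] and from [q] to [max p q]; it is nonzero
    only where [min p q] equals [q]. *)
Lemma indirect_utility_submodular v p q : is_GS v ->
  indirect_utility v (fun j => Num.max (p j) (q j)) +
  indirect_utility v (fun j => Num.min (p j) (q j)) <=
  indirect_utility v p + indirect_utility v q.
Proof.
move=> vGS; have := indirect_utility_raise_le v
  (fun j => Num.min (p j) (q j)) q (fun j => p j - Num.min (p j) (q j)) vGS.
have Ep : (fun k => Num.min (p k) (q k) + (p k - Num.min (p k) (q k))) = p.
  by apply/funext => k; lra.
have Eq : (fun k => q k + (p k - Num.min (p k) (q k))) =
    (fun k => Num.max (p k) (q k)).
  by apply/funext => k; have := addr_max_min (p k) (q k); lra.
rewrite Ep Eq => H.
suff : indirect_utility v (fun j => Num.min (p j) (q j)) - indirect_utility v p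
  <= indirect_utility v q - indirect_utility v (fun j => Num.max (p j) (q j)).
  by lra.
apply: H => k; first by rewrite ge_min lexx orbT.
  by rewrite subr_ge0 ge_min lexx.
by rewrite subr_eq0 minEle; case: ifP; rewrite ?eqxx.
Qed.

End GrossSubstitutes.

(** * Ascending auctions and approximate duality *)

Section Market.
Context {R : realType} {m n : nat}.
Implicit Types (b : profile R m n) (p : prices R m) (S : bundle m).
Implicit Types X y z : 'I_n -> bundle m.

Definition disjoint_family X : Prop :=
  forall i k, i != k -> [disjoint X i & X k].

Lemma GS_le_total b k S : GS_profile b -> b k S <= \sum_l b l setT.
Proof.
move=> bGS; apply: le_trans (GS_le _ _ _ (bGS k) (subsetT S)) _.
by rewrite (bigD1 k) //= lerDl sumr_ge0 // => l _; apply: GS_ge0.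
Qed.

(* Ascending auction: agent k holds X k at the current prices p and sees the
   other items at p + e.  While some X k is not demanded, k takes a demanded
   superset of X k away from the others; gross substitutes lets the others keep
   what they do not lose.  c counts the price increments of each item. *)
Lemma kelso_crawford b (p0 : prices R m) (e : R) : GS_profile b -> 0 < e ->
  (forall j, 0 <= p0 j) ->
  exists (X : 'I_n -> bundle m) p,
    [/\ disjoint_family X, forall j, p0 j <= p j,
        forall j, (forall k, j \notin X k) -> p j = p0 j &
        forall k, in_demand (b k) (fun j => if j \in X k then p j else p j + e)
                    (X k)].
Proof.
move=> bGS e0 p0_ge0; pose V := \sum_k b k setT.
have bV k T : b k T <= V by exact: GS_le_total.
(* An item is taken only if one more increment keeps its price at most [V], so no item gets more
   than [K] increments. *)
pose K := Num.bound (V / e).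
have VK : V < K%:R * e.
  rewrite -ltr_pdivrMr // archi_boundP // divr_ge0 ?(ltW e0) // sumr_ge0 // => l _.
  exact: GS_ge0.
pose price (c : 'I_m -> nat) : prices R m := fun j => p0 j + (c j)%:R * e.
pose faced c (Z : bundle m) : prices R m :=
  fun j => if j \in Z then price c j else price c j + e.
pose inv (c : 'I_m -> nat) X :=
  [/\ disjoint_family X, forall j, (forall k, j \notin X k) -> c j = 0%N,
      forall j, (c j <= K)%N &
      forall k, exists2 D, in_demand (b k) (faced c (X k)) D & X k \subset D].
have price_ge0 c j : 0 <= price c j by rewrite addr_ge0 ?mulr_ge0 ?(ltW e0).
suff main N c X : inv c X -> (m * K < N + \sum_j c j)%N ->
    exists c' X', inv c' X' /\ forall k, in_demand (b k) (faced c' (X' k)) (X' k).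
  have [] := main (m * K).+1 (fun=> 0%N) (fun=> set0).
  - split=> // [i k _|k]; first by rewrite -setI_eq0 setI0.
    have [D Ddem _] :=
      indirect_utility_attained (b k) (faced (fun=> 0%N) set0).
    by exists D; rewrite ?sub0set.
  - by rewrite addSn ltnS leq_addr.
  move=> c [X [[Xdisj Xun _ _] dem]].
  exists X, (price c); split=> // [j|j /Xun cj].
    by rewrite /price lerDl mulr_ge0 ?(ltW e0).
  by rewrite /price cj mul0r addr0.
elim: N c X => [|N IH] c X [Xdisj Xun cK Xdem] meas.
  suff : (\sum_j c j <= m * K)%N by rewrite leqNgt meas.
  by rewrite -[X in (X * _)%N]card_ord -sum_nat_const leq_sum.
have [dem|/existsNP[k Xk]] :=
    pselect (forall k, in_demand (b k) (faced c (X k)) (X k)).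
  by exists c, X.
have [D Ddem XD] := Xdem k.
pose new := D :\: X k.
pose c' j := (c j + (j \in new))%N.
pose X' l := if l == k then D else X l :\: D.
have new_lt j : j \in new -> (c j < K)%N.
  rewrite in_setD => /andP[jX jD].
  have := Ddem (D :\ j); rewrite (price_ofD1 _ D j) // /faced (negPf jX).
  have := bV k D; have := GS_ge0 _ (D :\ j) (bGS k) => bD bVD bDj.
  rewrite -(ltr_nat R) -(ltr_pM2r e0); apply: le_lt_trans VK.
  have := p0_ge0 j; rewrite /price in bDj; lra.
have inv' : inv c' X'.
  split.
  - move=> i l il; rewrite /X'; case: ifP => [/eqP ik|_]; case: ifP => [/eqP lk|_].
    + by rewrite ik lk eqxx in il.
    + by rewrite disjoint_sym disjoint_setDl.
    + by rewrite disjoint_setDl.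
    + by apply: disjointW (Xdisj _ _ il); exact: subsetDl.
  - move=> j jX'; have jD : j \notin D by have := jX' k; rewrite /X' eqxx.
    rewrite /c' in_setD (negPf jD) andbF addn0 Xun // => l.
    have := jX' l; rewrite /X'; case: eqP => [->|_]; last by rewrite in_setD jD.
    move=> _.
    by apply: contra jD; apply: (subsetP XD).
  - move=> j; rewrite /c'; case: (boolP (j \in new)) => [/new_lt|_].
      by rewrite addn1.
    by rewrite addn0.
  move=> l; rewrite /X'; have [->|lk] := eqVneq l k.
    (* Agent [k] faces unchanged prices: the surcharge [e] on the items taken has become part of
       their price. *)
    exists D => //; suff -> : faced c' D = faced c (X k) by [].
    apply/funext => j; rewrite /faced /price /c' in_setD.
    have := subsetP XD j; case: (j \in D); case: (j \in X k) => /= DX; rewrite ?addn0 //.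
      by rewrite natrD; lra.
    by have := DX isT.
  have [Dl Dldem XDl] := Xdem l.
  have dis j : j \in X l -> j \in X k = false.
    by move=> jl; exact: disjointFr (Xdisj _ _ lk) jl.
  (* For agent [l] the items kept retain their price, since they avoid [D], and the other prices can
     only rise. *)
  have [j|T [Tdem Tin]] := (bGS l).2 (faced c (X l)) (faced c' (X l :\: D)) _ _ Dldem.
    rewrite /faced /price /c' natrD !in_setD.
    have := dis j; case: (j \in X l) => [/(_ isT) ->|_];
      case: (j \in D); case: (j \in X k) => //=; lra.
  exists T => //; apply/subsetP => j; rewrite inE => /andP[jD jX].
  apply: Tin; first exact: (subsetP XDl).
  by rewrite /faced /price /c' !in_setD jX (negPf jD) andbF addn0.
apply: IH inv' _; apply: leq_trans meas _; rewrite addSnnS leq_add2l.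
rewrite /c' big_split /= -addn1 leq_add2l.
have [j jnew] : exists j, j \in new.
  apply/set0Pn; apply: contra_notN Xk; rewrite setD_eq0 => DX.
  have XE : X k = D by apply/eqP; rewrite eqEsubset XD DX.
  by rewrite {2}XE.
by rewrite (bigD1 j) //= jnew.
Qed.

(** The auction starts at [V + 1] on [S], which nobody can afford, and at zero elsewhere, so unsold
    items outside [S] stay free. Each agent falls short of its indirect utility by at most
    [m * e']. *)
Lemma approximate_duality b S (e : R) : GS_profile b -> 0 < e ->
  exists (X : 'I_n -> bundle m) p,
    [/\ disjoint_family X, forall k, [disjoint X k & S], forall j, 0 <= p j &
        \sum_k indirect_utility (b k) p + price_of p (~: S) <=
        welfare b X + e].
Proof.
move=> bGS e0; pose V := \sum_k b k setT.
have bV k T : b k T <= V by exact: GS_le_total.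
have V0 : 0 <= V by rewrite sumr_ge0 // => k _; apply: GS_ge0.
pose e' := e / (n * m).+1%:R.
have e'0 : 0 < e' by rewrite divr_gt0.
pose p0 : prices R m := fun j => if j \in S then V + 1 else 0.
have p0_ge0 j : 0 <= p0 j by rewrite /p0; case: ifP; lra.
have [X [p [Xdisj pp0 unsold dem]]] := kelso_crawford b p0 e' bGS e'0 p0_ge0.
have p_ge0 j : 0 <= p j by apply: le_trans (pp0 j).
exists X, p; split=> // [k|].
  rewrite -setI_eq0; apply/set0Pn => -[j]; rewrite inE => /andP[jX jS].
  have := dem k set0; rewrite {1}/price_of big_set0 (bGS k).1.1.
  rewrite (price_ofD1 _ (X k) j) // jX; set rest := price_of _ _.
  have : 0 <= rest by apply: price_of_ge0 => l; case: ifP; rewrite ?addr_ge0 // ltW.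
  by have := pp0 j; rewrite /p0 jS; have := bV k (X k); lra.
have U_le k : indirect_utility (b k) p <= b k (X k) - price_of p (X k) + m%:R * e'.
  have [T _ ->] := indirect_utility_attained (b k) p.
  have := dem k T; set r := fun j => _.
  have -> : price_of r (X k) = price_of p (X k).
    by apply: eq_bigr => j jX; rewrite /r jX.
  have : price_of r T <= price_of p T + m%:R * e'.
    rewrite -[m in m%:R]card_ord mulr_natl -sumr_const.
    rewrite /price_of [X in _ <= X + _]big_mkcond [leLHS]big_mkcond -big_split /=.
    apply: ler_sum => j _; case: ifP => _; last by rewrite add0r ltW.
    by rewrite /r; case: ifP; rewrite ?lerD2l ?lerDl // ltW.
  lra.
have sold : price_of p (~: S) <= \sum_k price_of p (X k).
  rewrite /price_of -partition_disjoint_bigcup //.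
  rewrite [leLHS](big_setID (\bigcup_k X k)) /= [X in _ + X]big1 ?addr0.
    by apply: price_of_le => //; exact: subsetIr.
  move=> j; rewrite !inE => /andP[jX jS]; rewrite unsold ?/p0 ?(negPf jS) // => k.
  by apply: contra jX => jXk; apply/bigcupP; exists k.
have : \sum_k indirect_utility (b k) p <=
    \sum_k (b k (X k) - price_of p (X k) + m%:R * e') by apply: ler_sum.
rewrite [X in _ <= X -> _]big_split /= [X in _ <= X + _ -> _]sumrB
  sumr_const card_ord -/(welfare b X).
have : (m%:R * e') *+ n <= e.
  rewrite -mulr_natl mulrA -natrM /e' mulrA ler_pdivrMr // mulrC ler_pM2l //.
  by rewrite ler_nat leqnSn.
lra.
Qed.

(** * Removing agents and items *)

Lemma upd_GS b i w : GS_profile b -> is_GS w -> GS_profile (upd b i w).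
Proof. by move=> bGS wGS k; rewrite /upd; case: ifP. Qed.

Lemma welfare_upd b i w y :
  welfare (upd b i w) y = w (y i) + \sum_(k | k != i) b k (y k).
Proof.
rewrite /welfare (bigD1 i) //= /upd eqxx; congr (_ + _).
by apply: eq_bigr => k /negPf->.
Qed.

(* Adding agent i and removing the items S both raise the marginal value of items:
   B(M) + B_{-i}(M \ S) >= B_{-i}(M) + B(M \ S), where B denotes optimal welfare
   and W, W' bound the terms on the left.  If p, q are dual-optimal for the two
   markets on the left, then min p q and max p q are dual-feasible for those on
   the right. *)
Lemma agents_items_substitutes b i S y z (W W' : R) : GS_profile b ->
  disjoint_family y -> disjoint_family z -> (forall k, [disjoint z k & S]) ->
  (forall X, disjoint_family X -> welfare b X <= W) ->
  (forall X, disjoint_family X -> (forall k, [disjoint X k & S]) ->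
     \sum_(k | k != i) b k (X k) <= W') ->
  \sum_(k | k != i) b k (y k) + welfare b z <= W + W'.
Proof.
move=> bGS ydisj zdisj zS bW bW'; apply/ler_addgt0Pr => e e0.
(* Duality is only approximate; each of the two markets contributes an error [e / 2]. *)
have e20 : 0 < e / 2 by rewrite divr_gt0.
have b0GS := upd_GS b i _ bGS zero_GS.
have [X [p [Xdisj _ p0 Xp]]] := approximate_duality b set0 (e / 2) bGS e20.
have [X' [q [X'disj X'S q0 Xq]]] := approximate_duality _ S (e / 2) b0GS e20.
have := bW X Xdisj; have := bW' X' X'disj X'S.
rewrite welfare_upd add0r in Xq.
rewrite setC0 in Xp.
pose hi j := Num.max (p j) (q j); pose lo j := Num.min (p j) (q j).
have lo0 j : 0 <= lo j by rewrite le_min p0 q0.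
have UE f r : \sum_k indirect_utility (upd b i f k) r =
    indirect_utility f r + \sum_(k | k != i) indirect_utility (b k) r.
  rewrite (bigD1 i) //= /upd eqxx; congr (_ + _).
  by apply: eq_bigr => k /negPf->.
rewrite UE indirect_utility_zero // add0r in Xq.
rewrite (bigD1 i) //= in Xp.
have Uy : \sum_(k | k != i) b k (y k) <=
    \sum_(k | k != i) indirect_utility (b k) lo + price_of lo setT.
  apply: (@le_trans _ _ (\sum_(k | k != i)
      (indirect_utility (b k) lo + price_of lo (y k)))).
    by apply: ler_sum => k _; have := indirect_utility_ub (b k) lo (y k); lra.
  rewrite big_split lerD2l; apply: (@le_trans _ _ (\sum_k price_of lo (y k))).
    by rewrite [leRHS](bigD1 i) //= lerDr price_of_ge0.
  rewrite /price_of -partition_disjoint_bigcup //.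
  by apply: price_of_le.
have Uz : welfare b z <=
    \sum_k indirect_utility (b k) hi + price_of hi (~: S).
  apply: (@le_trans _ _ (\sum_k
      (indirect_utility (b k) hi + price_of hi (z k)))).
    by apply: ler_sum => k _; have := indirect_utility_ub (b k) hi (z k); lra.
  rewrite big_split lerD2l /price_of -partition_disjoint_bigcup //.
  apply: price_of_le => [j|]; first by rewrite le_max p0.
  by apply/bigcupsP => k _; rewrite subsets_disjoint setCK.
rewrite (bigD1 i) //= in Uz.
have Ui : indirect_utility (b i) hi <= indirect_utility (b i) p.
  by apply: indirect_utility_le => j; rewrite le_max lexx.
have Usub : \sum_(k | k != i) indirect_utility (b k) hi +
    \sum_(k | k != i) indirect_utility (b k) lo <=
    \sum_(k | k != i) indirect_utility (b k) p +
    \sum_(k | k != i) indirect_utility (b k) q.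
  rewrite -!big_split; apply: ler_sum => k _.
  exact: indirect_utility_submodular.
(* Outside [S], [lo + hi = p + q] item by item; on [S] only [lo <= p] is at stake. *)
have prices_sum : price_of lo setT + price_of hi (~: S) <=
    price_of p setT + price_of q (~: S).
  have E f (T : bundle m) :
      price_of f T = \sum_j (if j \in T then f j else 0 : R).
    by rewrite /price_of big_mkcond.
  rewrite !E -!big_split; apply: ler_sum => j _; rewrite !inE /=.
  have := addr_max_min (p j) (q j); rewrite -/(hi j) -/(lo j).
  have : lo j <= p j by rewrite ge_min lexx.
  by case: (j \in S) => /=; lra.
lra.
Qed.

(** At prices supporting [f] at [A], removing [y i] loses at most the price of [A :&: y i], and
    these sets are disjoint. *)
Lemma sum_removal_le (f : valfun R m) (A : bundle m) y : is_GS f ->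
  disjoint_family y -> \sum_i (f A - f (A :\: y i)) <= f A.
Proof.
move=> fGS ydisj; have [c [c0 cA cle]] := GS_supporting_prices f A fGS.
apply: (@le_trans _ _ (\sum_i price_of c (A :&: y i))).
  apply: ler_sum => i _; have := cle (A :\: y i); rewrite -cA.
  by rewrite [price_of c A](big_setID (y i)) /= /price_of; lra.
rewrite /price_of -partition_disjoint_bigcup => [|i k ik]; last first.
  by apply: disjointW (ydisj _ _ ik); exact: subsetIr.
by rewrite -cA; apply: price_of_le => //; apply/bigcupsP => i _; exact: subsetIl.
Qed.

End Market.

Theorem theorem1 (R : realType) (m n : nat)
    (x : profile R m n -> 'I_n -> bundle m) (pi : profile R m n -> 'I_n -> R)
    (gamma : R) (v b : profile R m n) :
  declared_welfare_maximizer x pi ->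
  0 <= gamma ->
  GS_profile v ->
  pure_nash x pi v b ->
  (forall i : 'I_n, exposure x pi gamma (v i) i (b i)) ->
  forall xstar : 'I_n -> bundle m,
    is_partition xstar ->
    (forall y, is_partition y -> welfare v y <= welfare v xstar) ->
    welfare v xstar <= (4 + 2 * gamma) * welfare v (x b).
Proof.
move=> dwm _ vGS [bGS nash] expo xs [xsdisj _] _.
have [[xdisj xcov] xopt pi_ge0 _ pi_tight] := dwm b bGS.
(* The mechanism is optimal among partitions only, so leftover items are handed to agent [i];
   monotonicity makes this harmless. *)
have extend (X : 'I_n -> bundle m) (i : 'I_n) : disjoint_family X ->
    exists2 Y, is_partition Y & X i \subset Y i /\ forall k, k != i -> Y k = X k.
  move=> Xdisj.
  exists (fun k => if k == i then ~: \bigcup_(l | l != i) X l else X k).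
    have out k : k != i -> [disjoint ~: \bigcup_(l | l != i) X l & X k].
      by move=> ki; rewrite disjoint_sym -subsets_disjoint (bigcup_sup k).
    split=> [k l kl|j].
      case: ifP => [/eqP ki|ki]; case: ifP => [/eqP li|li].
      - by rewrite ki li eqxx in kl.
      - by apply: out; rewrite li.
      - by rewrite disjoint_sym; apply: out; rewrite ki.
      - exact: Xdisj.
    have [/bigcupP[k ki jk]|jU] := boolP (j \in \bigcup_(l | l != i) X l).
      by exists k; rewrite (negPf ki).
    by exists i; rewrite eqxx inE.
  split=> [|k /negPf -> //]; rewrite eqxx.
  apply/subsetP => j ji; rewrite inE; apply/bigcupP => -[k ki jk].
  by have /disjointFr/(_ jk) := Xdisj _ _ ki; rewrite ji.
have bopt X : disjoint_family X -> welfare b X <= welfare b (x b).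
  (* With no agents nobody can take the leftovers, but both welfare sums are empty. *)
  move=> Xdisj; case: (pselect (exists i : 'I_n, True)) => [[i _]|n0]; last first.
    by rewrite /welfare !big1 // => i _; case: n0; exists i.
  have [Y Ypart [Yi Yk]] := extend X i Xdisj.
  apply: le_trans (xopt Y Ypart); apply: ler_sum => k _.
  by have [->|/Yk ->//] := eqVneq k i; apply: GS_le.
(* The declared optimum without [xs i] is bounded below by deleting [xs i] from the bundles of
   [x b]; the sum is the resulting loss. *)
have deviation i : v i (xs i) / 2 -
    \sum_k (b k (x b k) - b k (x b k :\: xs i)) <= v i (x b i).
  have [a [a0 aS aT]] := GS_supporting_prices _ (xs i) (vGS i).
  pose w : valfun R m := price_of (fun j => a j / 2).
  have wE T : w T = price_of a T / 2 by rewrite /w /price_of mulr_suml.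
  have wGS : is_GS w by apply: additive_GS => j; rewrite divr_ge0.
  have b'GS := upd_GS _ i _ bGS wGS.
  have [[ydisj _] yopt _ pay _] := dwm _ b'GS.
  set y := x (upd b i w) in ydisj yopt pay.
  have zdisj : disjoint_family (fun k => x b k :\: xs i).
    by move=> k l /xdisj; apply: disjointW; exact: subsetDl.
  have zS k : [disjoint x b k :\: xs i & xs i].
    by rewrite disjoint_setDl.
  have rest_opt X : disjoint_family X -> (forall k, [disjoint X k & xs i]) ->
      \sum_(k | k != i) b k (X k) <= welfare (upd b i w) y - w (xs i).
    move=> Xdisj XS.
    pose X1 k := if k == i then xs i else X k.
    have X1disj : disjoint_family X1.
      move=> k l kl; rewrite /X1.
      have [ki|_] := eqVneq k i; have [li|_] := eqVneq l i.
      - by rewrite ki li eqxx in kl.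
      - by rewrite disjoint_sym.
      - exact: XS.
      - exact: Xdisj.
    have [Y Ypart [Yi Yk]] := extend X1 i X1disj.
    have := yopt Y Ypart; rewrite welfare_upd.
    have -> : \sum_(k | k != i) b k (Y k) = \sum_(k | k != i) b k (X k).
      by apply: eq_bigr => k ki; rewrite Yk // /X1 (negPf ki).
    rewrite /X1 eqxx in Yi; have := GS_le w _ _ wGS Yi; lra.
  have := agents_items_substitutes b i (xs i) y _ _ _ bGS ydisj zdisj zS bopt
    rest_opt.
  have -> : welfare b (fun k => x b k :\: xs i) = welfare b (x b) -
      \sum_k (b k (x b k) - b k (x b k :\: xs i)).
    by rewrite /welfare -sumrB; apply: eq_bigr => k _; lra.
  have payi : pi (upd b i w) i <= w (y i).
    by apply: le_trans (pay i) _; rewrite /upd eqxx.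
  have := nash i w wGS; rewrite /utility -/y welfare_upd.
  by have := pi_ge0 i; have := aT (y i); have := wE (y i); have := wE (xs i); lra.
(* Some rival bids make agent [i] pay its full bid for the same bundle, so bounded exposure limits
   the bid itself. *)
have declared i : b i (x b i) <= (1 + gamma) * v i (x b i).
  have [b' [b'GS [xE piE]]] := pi_tight i.
  by have := expo i b' b'GS; rewrite xE piE.
have total : \sum_i (v i (xs i) / 2 - \sum_k (b k (x b k) - b k (x b k :\: xs i)))
    <= welfare v (x b) by apply: ler_sum.
(* After exchanging the sums, the losses of each agent [k] total at most [b k (x b k)]. *)
have overcount : \sum_i \sum_k (b k (x b k) - b k (x b k :\: xs i)) <=
    welfare b (x b).
  by rewrite exchange_big; apply: ler_sum => k _; apply: sum_removal_le.
have overbid : welfare b (x b) <= (1 + gamma) * welfare v (x b).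
  by rewrite /welfare mulr_sumr; apply: ler_sum.
move: total; rewrite sumrB -mulr_suml -/(welfare v xs).
lra.
Qed.
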